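(* Let $g$ be a computable order with $g(n+1)\leq g(n)+1$ for all $n$. Every random real computes a perfect tree $T$ with $\log|T\cap 2^n|=g(n)$ and \[ \lim_n\big(\log|T\cap 2^n|-\mathsf{d}(T\cap 2^n)\big)=\infty . \]
   Context: $2^{<\omega}$ is the set of finite binary strings, $2^n$ the set of $n$-bit strings; reals are infinite binary sequences. $K$ is prefix-free Kolmogorov complexity; $\log$ is base 2. ''Random'' means Martin-Löf random. An order is a nondecreasing unbounded function $\mathbb{N}\to\mathbb{N}$. A tree is a set $T\subseteq 2^{<\omega}$ that is downward-closed under the prefix relation $\preceq$. $T$ is perfect if each string in $T$ has at least two $\preceq$-incomparable strict extensions in $T$; trees are assumed pruned (no $\preceq$-maximal elements) and proper ($|T\cap 2^n|$ is unbounded in $n$). For a set $E$ of strings, $\mathsf{d}(E)=\sup_{\sigma\in E}(|\sigma|-K(\sigma))$. ''$z$ computes $T$'' means $T\leq_T z$ (Turing reducibility).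
   Formalization: The formal statement adds the assumption g(0)=0, which is forced: there is only one string of length 0, so log|T∩2^0|=g(0) fails whenever g(0)>0 (for example g(n)=n+1). *)

(* Defs.v *)
(* MathComp / MathComp-Analysis *)
From HB Require Import structures.
From mathcomp Require Import all_boot all_order all_algebra.
From mathcomp Require Import all_classical all_reals all_analysis.

Set Implicit Arguments.
Unset Strict Implicit.
Unset Printing Implicit Defensive.

Import Order.TTheory GRing.Theory Num.Theory.
Import numFieldNormedType.Exports.

Local Open Scope classical_set_scope.
Local Open Scope ring_scope.

(* Kleene's partial recursive functions relative to an oracle.  Arguments are
   passed as a list and arities are not enforced: a missing argument reads as 0
   and extra arguments are ignored. *)
Inductive rcode : Type :=
  | RZero
  | RSucc
  | RProj of nat
  | ROracle
  | RComp of rcode & seq rcode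
  | RPrec of rcode & rcode
  | RMin of rcode.

(* [reval A c v y]: with oracle A, the function coded by c is defined at the
   arguments v, with value y.  The head of v is the recursion variable of RPrec,
     h(0, v) = f(v),   h(n + 1, v) = g(h(n, v), n, v),
   and the search variable of RMin. *)
Fixpoint reval (A : nat -> bool) (c : rcode) (v : seq nat) (y : nat) : Prop :=
  match c with
  | RZero => y = 0%N
  | RSucc => y = (nth 0%N v 0).+1
  | RProj i => y = nth 0%N v i
  | ROracle => y = nat_of_bool (A (nth 0%N v 0))
  | RComp f gs =>
      exists ws : seq nat,
        (fix revals (gs : seq rcode) (ws : seq nat) : Prop :=
           match gs, ws with
           | [::], [::] => True
           | g :: gs', w :: ws' => reval A g v w /\ revals gs' ws'
           | _, _ => False
           end) gs ws
        /\ reval A f ws y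
  | RPrec f g =>
      (fix iterate (n y : nat) : Prop :=
         match n with
         | 0%N => reval A f (behead v) y
         | n'.+1 => exists w, iterate n' w
                      /\ reval A g [:: w, n' & behead v] y
         end) (nth 0%N v 0) y
  | RMin f =>
      reval A f (y :: v) 0%N
      /\ forall k, (k < y)%N -> exists w, reval A f (k :: v) w.+1
  end.

(* Unrelativized computation is computation with the empty oracle. *)
Definition no_oracle : nat -> bool := fun=> false.

(* The bijection 2^{<omega} -> nat given by bijective base-2 numeration, least
   significant digit first (the bits 0, 1 being read as the digits 1, 2). *)
Fixpoint code_str (s : bitseq) : nat :=
  if s is b :: s' then ((code_str s').*2 + b).+1 else 0%N.

Definition computable_fun (g : nat -> nat) : Prop :=
  exists c, forall n, reval no_oracle c [:: n] (g n).

Definition partial_computable_str (M : bitseq -> bitseq -> Prop) : Prop :=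
  exists c, forall p s,
    M p s <-> reval no_oracle c [:: code_str p] (code_str s).

Definition uniformly_ce (W : nat -> set bitseq) : Prop :=
  exists c, forall k s,
    W k s <-> exists y, reval no_oracle c [:: k; code_str s] y.

Definition computes_strset (z : nat -> bool) (T : pred bitseq) : Prop :=
  exists c, forall s, reval z c [:: code_str s] (nat_of_bool (T s)).

Definition order_fun (g : nat -> nat) : Prop :=
  {homo g : m n / (m <= n)%N} /\ forall b, exists n, (b <= g n)%N.

Definition prefix_free_machine (M : bitseq -> bitseq -> Prop) : Prop :=
  partial_computable_str M
  /\ forall p q s t, M p s -> M q t -> prefix p q -> p = q.

(* +oo when s has no M-program. *)
Definition complexity (R : realType) (M : bitseq -> bitseq -> Prop)
    (s : bitseq) : \bar R :=
  ereal_inf [set ((size p)%:R%:E : \bar R) | p in [set p | M p s]].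

Definition optimal_machine (R : realType) (U : bitseq -> bitseq -> Prop)
    : Prop :=
  prefix_free_machine U
  /\ forall M, prefix_free_machine M -> exists b : nat, forall s,
       (complexity R U s <= complexity R M s + b%:R%:E)%E.

(* d(E), for the complexity given by the machine U. *)
Definition deficiency (R : realType) (U : bitseq -> bitseq -> Prop)
    (E : set bitseq) : \bar R :=
  ereal_sup [set ((size s)%:R%:E - complexity R U s)%E | s in E].

Definition open_class (W : set bitseq) : set (nat -> bool) :=
  [set X | exists2 s, W s & s = mkseq X (size s)].

(* The outer measure on 2^omega induced by mu [s] = 2^{-|s|}; it is the uniform
   measure on Borel classes, in particular on open ones. *)
Definition uniform_measure (R : realType) (A : set (nat -> bool)) : \bar R :=
  ereal_inf [set \esum_(s in D) ((2^-1 : R) ^+ size s)%:E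
            | D in [set D | A `<=` open_class D]].

Definition ml_test (R : realType) (W : nat -> set bitseq) : Prop :=
  uniformly_ce W
  /\ forall k, (uniform_measure R (open_class (W k)) <= ((2^-1 : R) ^+ k)%:E)%E.

Definition ml_random (R : realType) (z : nat -> bool) : Prop :=
  forall W, ml_test R W -> ~ (\bigcap_k open_class (W k)) z.

(* T \cap 2^n. *)
Definition level (T : pred bitseq) (n : nat) : {set n.-tuple bool} :=
  [set t : n.-tuple bool | T (tval t)]%SET.

Definition level_set (T : pred bitseq) (n : nat) : set bitseq :=
  [set tval t | t in [set` level T n]].

Definition tree (T : pred bitseq) : Prop :=
  [/\ forall s t, T t -> prefix s t -> T s,
      forall s, T s -> exists t, [/\ T t, prefix s t & t != s]
    & forall b, exists n, (b <= #|level T n|)%N].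

Definition perfect (T : pred bitseq) : Prop :=
  forall s, T s -> exists t u,
    [/\ T t, T u, prefix s t && (t != s), prefix s u && (u != s)
      & ~~ prefix t u && ~~ prefix u t].

Definition log2 (R : realType) (x : R) : R := ln x / ln 2.

(* Main.v *)
(* Read the bits of z as indexed by finite strings.  The tree T has all
   strings branch at the levels n with g (n + 1) = g n + 1, and at the other
   levels each node s of T has as its only child the one given by the bit of z at
   address s.  A fixed string s then belongs to T with probability
   2 ^ -(|s| - g |s|), so that the sum over the programs p of U whose output s
   is in T of 2 ^ (|s| - g |s| - |p|) has expectation at most 1, by Kraft's
   inequality.  This sum is lower semicomputable in z, so by Markov's inequality
   it yields a Martin-Löf test, and it is finite when z is random.  Hence its
   terms tend to 0, which is the claim. *)

(* The relation [reval] carries no notion of time, whereas lower semicomputability of the sum and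
   enumerability of the test both need finite approximations. Hence every code gets an evaluator by
   stages that is itself computed by a code. A single number L then serves as time bound, as bound
   on the programs considered, as bound on the addresses of the bits of z that are read, and as
   scaling exponent: multiplied by [2 ^ L], the stage L sum is a natural number that depends on L
   bits only. Probabilities become counts among the [2 ^ L] assignments of these bits, so that
   expectation and Markov's inequality are statements about finite sums of natural numbers.

   The probability given for s rests on two facts. Since g starts at 0 and rises by 0 or 1, exactly
   |s| - g |s| proper prefixes of s end at nonbranching levels; and these prefixes have distinct
   addresses, so their constraints are independent.

   A term of the sum is at most 2 ^ -j exactly when |p| is at least |s| - g |s| + j. If this holds
   for all programs of all s in T of length n, the deficiency of level n is at most g n - j. *)
Require Import Defs.
From HB Require Import structures.
From mathcomp Require Import all_boot all_order all_algebra.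
From mathcomp Require Import all_classical all_reals all_analysis.
From mathcomp Require Import zify lra.
Import Order.TTheory GRing.Theory Num.Theory.
Import numFieldNormedType.Exports.
Local Open Scope classical_set_scope.
Local Open Scope ring_scope.

(** * Closure properties of the functions computable with an oracle *)

Section Computability.
Local Open Scope nat_scope.
Set Implicit Arguments.
Unset Strict Implicit.

Local Notation arg v i := (nth 0 v i).

(** The generated principle has no hypothesis for the codes inside the list of [RComp]. Reading that
    list with default [RZero] gives the hypothesis at every index, since [P RZero] is available. *)
Lemma rcode_nested_ind (P : rcode -> Prop) :
  P RZero -> P RSucc -> (forall i, P (RProj i)) -> P ROracle ->
  (forall f gs, P f -> (forall i, P (nth RZero gs i)) -> P (RComp f gs)) ->
  (forall f g, P f -> P g -> P (RPrec f g)) ->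
  (forall f, P f -> P (RMin f)) ->
  forall c, P c.
Proof.
move=> P0 PS Pp Po Pc Pr Pm; fix IH 1 => -[||i||f gs|f g|f].
- exact: P0.
- exact: PS.
- exact: Pp.
- exact: Po.
- apply: Pc; first exact: IH.
  elim: gs => [|g gs IHgs] [|i] /=; [exact: P0|exact: P0|exact: IH|exact: IHgs].
- by apply: Pr; exact: IH.
- by apply: Pm; exact: IH.
Qed.

Lemma reval_comp A f gs v y :
  reval A (RComp f gs) v y <->
  exists ws, [/\ size ws = size gs,
    forall i, i < size gs -> reval A (nth RZero gs i) v (arg ws i)
    & reval A f ws y].
Proof.
have E ws : (fix revals (gs : seq rcode) (ws : seq nat) : Prop :=
           match gs, ws with
           | [::], [::] => True
           | g :: gs', w :: ws' => reval A g v w /\ revals gs' ws'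
           | _, _ => False
           end) gs ws <-> size ws = size gs /\
    forall i, i < size gs -> reval A (nth RZero gs i) v (arg ws i).
  elim: gs ws => [|g gs IH] [|w ws] /=; split=> //; try by case.
  - by case=> gw /IH[-> H]; split=> // -[|i] //=; exact: H.
  - case=> -[sz] H; split; first exact: (H 0).
    by apply/IH; split=> // i; exact: (H i.+1).
by split=> [[ws [/E[sz H] fy]]|[ws [sz H fy]]]; exists ws; split=> //; apply/E.
Qed.

Lemma reval_fun A c v y y' : reval A c v y -> reval A c v y' -> y = y'.
Proof.
elim/rcode_nested_ind: c v y y' => [||i||f gs IHf IHgs|f g IHf IHg|f IHf] v y y'.
1-4: by move=> /= -> ->.
- move=> /reval_comp[ws [sz H fy]] /reval_comp[ws' [sz' H' fy']].
  suff E : ws = ws' by rewrite E in fy; exact: IHf fy fy'.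
  apply: (eq_from_nth (x0 := 0)); rewrite sz ?sz' // => i Hi.
  exact: IHgs (H _ Hi) (H' _ Hi).
- move=> /=; elim: (arg v 0) y y' => [|n IH] y y'; first exact: IHf.
  by move=> [w [/IH Hw gy]] [w' [/Hw ? gy']]; subst w'; exact: IHg gy gy'.
- move=> /= [fy Hy] [fy' Hy'].
  by case: (ltngtP y y') => // [/Hy'|/Hy] [w Hw];
    [have := IHf _ _ _ fy Hw|have := IHf _ _ _ fy' Hw].
Qed.

(** The empty oracle answers every query with 0, as [RZero] does. This makes unrelativized
    computations, such as that of g, available under any oracle. *)
Fixpoint erase_oracle (c : rcode) : rcode :=
  match c with
  | ROracle => RZero
  | RComp f gs => RComp (erase_oracle f) (map erase_oracle gs)
  | RPrec f g => RPrec (erase_oracle f) (erase_oracle g)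
  | RMin f => RMin (erase_oracle f)
  | _ => c
  end.

Lemma reval_erase_oracle A c v y :
  reval no_oracle c v y -> reval A (erase_oracle c) v y.
Proof.
elim/rcode_nested_ind: c v y => [||i||f gs IHf IHgs|f g IHf IHg|f IHf] v y //.
- move=> /reval_comp[ws [sz H fy]]; apply/reval_comp; exists ws.
  rewrite size_map; split=> // [i Hi|]; last exact: IHf.
  by rewrite (nth_map RZero) //; apply/IHgs/H.
- move=> /=; elim: (arg v 0) y => [|n IH] y; first exact: IHf.
  by move=> [w [/IH ? /IHg ?]]; exists w.
- move=> /= [/IHf fy H]; split=> // k /H[w /IHf ?].
  by exists w.
Qed.

Definition computes A m (f : seq nat -> nat) :=
  exists c, forall v, size v = m -> reval A c v (f v).

Lemma computes_ext A m f f' : (forall v, size v = m -> f v = f' v) ->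
  computes A m f -> computes A m f'.
Proof. by move=> E [c H]; exists c => v sz; rewrite -E //; exact: H. Qed.

Lemma computes_arg A m i : computes A m (fun v => arg v i).
Proof. by exists (RProj i). Qed.

Lemma computes_app A m k f (F : seq nat -> seq nat) : computes A k f ->
  (forall v, size v = m -> size (F v) = k) ->
  (forall i, i < k -> computes A m (fun v => arg (F v) i)) ->
  computes A m (fun v => f (F v)).
Proof.
move=> [c Hc] sz HF.
have /choice[h Hh] : forall i, exists d, i < k ->
    forall v, size v = m -> reval A d v (arg (F v) i).
  by move=> i; case: (ltnP i k) => [/HF[d]|]; [exists d | exists RZero].
exists (RComp c (mkseq h k)) => v szv; apply/reval_comp; exists (F v).
rewrite size_mkseq; split; [exact: sz| |exact: Hc (sz _ szv)].
by move=> i Hi; rewrite nth_mkseq //; exact: Hh.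
Qed.

Lemma computes_behead A m f : computes A m f ->
  computes A m.+1 (fun w => f (behead w)).
Proof.
move=> Hf; apply: computes_app Hf _ _ => [v|i _]; first by rewrite size_behead => ->.
apply: computes_ext (computes_arg A _ i.+1) => v _.
by rewrite nth_behead.
Qed.

Lemma computes_succ A m f : computes A m f -> computes A m (fun v => (f v).+1).
Proof.
move=> Hf; apply: (@computes_app A m 1 (fun v => (arg v 0).+1) (fun v => [:: f v])) => //.
- by exists RSucc.
- by case.
Qed.

Lemma computes_const A m k : computes A m (fun=> k).
Proof. by elim: k => [|k]; [exists RZero | exact: computes_succ]. Qed.

Lemma computes_oracle A m f :
  computes A m f -> computes A m (fun v => A (f v) : nat).
Proof.
move=> Hf.
apply: (@computes_app A m 1 (fun v => A (arg v 0) : nat) (fun v => [:: f v])) => //.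
- by exists ROracle.
- by case.
Qed.

Lemma computes_fun A m f a :
  computable_fun f -> computes A m a -> computes A m (fun v => f (a v)).
Proof.
move=> [c Hc] Ha.
apply: (@computes_app A m 1 (fun v => f (arg v 0)) (fun v => [:: a v])) => //.
- by exists (erase_oracle c) => -[|n []] // _; exact: reval_erase_oracle.
- by case.
Qed.

(** [RPrec] recurses on its first argument, so [N v] is put in front of [v]; the step code then
    receives the accumulator, the index and [v], in this order. *)
Lemma computes_iteri A m N F G : computes A m N -> computes A m F ->
  computes A m.+2 (fun w => G (arg w 0) (arg w 1) (behead (behead w))) ->
  computes A m (fun v => iteri (N v) (fun i r => G r i v) (F v)).
Proof.
move=> HN [cF HF] [cG HG].
apply: (@computes_app A m m.+1
  (fun w => iteri (arg w 0) (fun i r => G r i (behead w)) (F (behead w)))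
  (fun v => N v :: v)) => [|v /= ->|[|i] _] //; last exact: computes_arg.
exists (RPrec cF cG) => -[|n v] //= [sz].
elim: n => [|n IH] /=; first exact: HF.
exists (iteri n (fun i r => G r i v) (F v)); split=> //.
have := HG [:: iteri n (fun i r => G r i v) (F v), n & v].
by rewrite /= sz; apply.
Qed.

Section Arithmetic.
Variables (A : nat -> bool) (m : nat).
Implicit Types a b : seq nat -> nat.

Lemma computes_add a b : computes A m a -> computes A m b ->
  computes A m (fun v => a v + b v).
Proof.
move=> Ha Hb; have := @computes_iteri A m b a (fun r _ _ => r.+1) Hb Ha.
move=> /(_ (computes_succ (computes_arg _ _ _))).
apply: computes_ext => v _.
by elim: (b v) => [|n /= ->]; rewrite ?addn0 ?addnS.
Qed.

Lemma computes_pred a : computes A m a -> computes A m (fun v => (a v).-1).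
Proof.
move=> Ha; have := @computes_iteri A m a (fun=> 0) (fun _ i _ => i) Ha (computes_const _ _ _).
move=> /(_ (computes_arg _ _ _)).
by apply: computes_ext => v _; case: (a v).
Qed.

(** Case distinction by iteration: a constant step overrides the initial value as soon as it is
    taken once. *)
Lemma computes_if0 p a b : computes A m p -> computes A m a -> computes A m b ->
  computes A m (fun v => if p v is 0 then a v else b v).
Proof.
move=> Hp Ha Hb; have := @computes_iteri A m p a (fun _ _ => b) Hp Ha.
move=> /(_ (computes_behead (computes_behead Hb))).
by apply: computes_ext => v _; case: (p v).
Qed.
End Arithmetic.

Lemma computes_if A m (p : seq nat -> bool) a b :
  computes A m (fun v => p v : nat) -> computes A m a -> computes A m b ->
  computes A m (fun v => if p v then a v else b v).
Proof.
move=> Hp Ha Hb; have := computes_if0 Hp Hb Ha.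
by apply: computes_ext => v _; case: (p v).
Qed.

Lemma computes_negb A m (p : seq nat -> bool) : computes A m (fun v => p v : nat) ->
  computes A m (fun v => ~~ p v : nat).
Proof.
move=> Hp; have := computes_if Hp (computes_const _ _ 0) (computes_const _ _ 1).
by apply: computes_ext => v _; case: (p v).
Qed.

Lemma computes_or A m (p q : seq nat -> bool) :
  computes A m (fun v => p v : nat) -> computes A m (fun v => q v : nat) ->
  computes A m (fun v => p v || q v : nat).
Proof.
move=> Hp Hq; have := computes_if Hp (computes_const _ _ 1) Hq.
by apply: computes_ext => v _; case: (p v).
Qed.

Lemma computes_and A m (p q : seq nat -> bool) :
  computes A m (fun v => p v : nat) -> computes A m (fun v => q v : nat) ->
  computes A m (fun v => p v && q v : nat).
Proof.
move=> Hp Hq; have := computes_if Hp Hq (computes_const _ _ 0).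
by apply: computes_ext => v _; case: (p v).
Qed.

Lemma computes_sub A m a b : computes A m a -> computes A m b ->
  computes A m (fun v => a v - b v).
Proof.
move=> Ha Hb; have := @computes_iteri A m b a (fun r _ _ => r.-1) Hb Ha.
move=> /(_ (computes_pred (computes_arg _ _ _))).
apply: computes_ext => v _.
by elim: (b v) => [|n /= ->]; rewrite ?subn0 ?subnS.
Qed.

Lemma computes_leq A m a b : computes A m a -> computes A m b ->
  computes A m (fun v => a v <= b v : nat).
Proof.
move=> Ha Hb; have := computes_if0 (computes_sub Ha Hb)
  (computes_const _ _ 1) (computes_const _ _ 0).
by apply: computes_ext => v _; rewrite -subn_eq0; case: (a v - b v).
Qed.

Lemma computes_eq A m a b : computes A m a -> computes A m b ->
  computes A m (fun v => a v == b v : nat).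
Proof.
move=> Ha Hb; have := computes_and (computes_leq Ha Hb)
  (computes_leq Hb Ha).
by apply: computes_ext => v _; rewrite eqn_leq.
Qed.

Lemma computes_sum A m N F : computes A m N ->
  computes A m.+1 (fun w => F (arg w 0) (behead w)) ->
  computes A m (fun v => \sum_(i < N v) F i v).
Proof.
move=> HN HF; have := @computes_iteri A m N (fun=> 0) (fun r i v => r + F i v) HN
  (computes_const _ _ 0).
move=> /(_ _)/(@computes_ext _ _ _ _ _); apply.
  by move=> v _; elim: (N v) => [|n /= ->]; rewrite ?big_ord0 ?big_ord_recr.
apply: computes_add; first exact: computes_arg.
apply: (@computes_app A m.+2 m.+1 _ (fun w => arg w 1 :: behead (behead w)) HF) => [w /=|[|i] _ /=].
- by rewrite !size_behead => ->.
- exact: computes_arg.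
- apply: computes_ext (computes_arg A _ i.+2) => w _.
  by rewrite !nth_behead.
Qed.

Lemma computes_all A m N (P : nat -> seq nat -> bool) : computes A m N ->
  computes A m.+1 (fun w => P (arg w 0) (behead w) : nat) ->
  computes A m (fun v => all (P^~ v) (iota 0 (N v)) : nat).
Proof.
move=> HN HP.
have := computes_eq (@computes_sum A m N (fun i v => ~~ P i v : nat) HN
  (computes_negb HP)) (computes_const _ _ 0).
apply: computes_ext => v _; congr nat_of_bool.
elim: (N v) => [|n IH]; first by rewrite big_ord0.
rewrite -[in RHS]addn1 iotaD all_cat add0n big_ord_recr /= addn_eq0 IH andbT.
by case: (P n v).
Qed.

Lemma computes_mul A m a b : computes A m a -> computes A m b ->
  computes A m (fun v => a v * b v).
Proof.
move=> Ha Hb; have := @computes_sum A m a (fun _ => b) Ha (computes_behead Hb).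
by apply: computes_ext => v _; rewrite sum_nat_const card_ord.
Qed.

Lemma computes_exp2 A m a : computes A m a -> computes A m (fun v => 2 ^ a v).
Proof.
move=> Ha; have := @computes_iteri A m a (fun=> 1) (fun r _ _ => r + r) Ha
  (computes_const _ _ 1).
move=> /(_ (computes_add (computes_arg _ _ _) (computes_arg _ _ _))).
apply: computes_ext => v _.
by elim: (a v) => [|n /= ->] //; rewrite expnS mul2n addnn.
Qed.

Lemma computes_odd A m a : computes A m a -> computes A m (fun v => odd (a v) : nat).
Proof.
move=> Ha; have := @computes_iteri A m a (fun=> 0) (fun r _ _ => 1 - r) Ha
  (computes_const _ _ 0).
move=> /(_ (computes_sub (computes_const _ _ _) (computes_arg _ _ _))).
apply: computes_ext => v _.
by elim: (a v) => [|n /= ->] //; case: (odd n).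
Qed.

(** Half of n is the number of odd i below n. *)
Lemma computes_half A m a : computes A m a -> computes A m (fun v => (a v)./2).
Proof.
move=> Ha; have := @computes_sum A m a (fun i _ => odd i : nat) Ha
  (computes_odd (computes_arg _ _ _)).
apply: computes_ext => v _.
by elim: (a v) => [|n IH]; rewrite ?big_ord0 // big_ord_recr IH /= uphalf_half addnC.
Qed.

End Computability.

(** * Evaluation of codes in stages, within the model of computation *)

Section StepEvaluation.
Local Open Scope nat_scope.
Set Implicit Arguments.
Unset Strict Implicit.

Local Notation arg v i := (nth 0 v i).

(** Unlike in [computes_all], each [P i] may have its own code, with no uniformity in [i]; the
    number of conjuncts is fixed for this reason. *)
Lemma computes_all_const A m k (P : nat -> seq nat -> bool) :
  (forall i, computes A m (fun v => P i v : nat)) ->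
  computes A m (fun v => all (P^~ v) (iota 0 k) : nat).
Proof.
move=> HP; elim: k => [|k IH]; first exact: (computes_const _ _ 1).
apply: computes_ext (computes_and IH (HP k)) => v _.
by rewrite -[in RHS]addn1 iotaD all_cat /= add0n andbT.
Qed.

Lemma eventually_all (Q : nat -> nat -> Prop) k :
  (forall i, i < k -> exists t, forall t', t <= t' -> Q i t') ->
  exists t, forall t', t <= t' -> forall i, i < k -> Q i t'.
Proof.
elim: k => [|k IH] H; first by exists 0.
have [|t Ht] := IH; first by move=> i Hi; apply: H; lia.
have [//|u Hu] := H k.
exists (maxn t u) => t'; rewrite geq_max => /andP[tt' ut'] i.
by rewrite ltnS leq_eqVlt => /predU1P[->|]; [exact: Hu | exact: Ht].
Qed.

(* [E t v] is 0 while the computation has not been seen to halt by stage t, and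
   the output plus one afterwards. *)
Definition stage_evaluator A c m (E : nat -> seq nat -> nat) :=
  [/\ computes A m.+1 (fun w => E (arg w 0) (behead w)),
      forall t t' v, t <= t' -> E t v != 0 -> E t' v = E t v
    & forall v y, size v = m -> (reval A c v y <-> exists t, E t v = y.+1)].

Lemma stage_evaluator_total A c m f : computes A m f ->
  (forall v y, reval A c v y <-> y = f v) ->
  stage_evaluator A c m (fun _ v => (f v).+1).
Proof.
move=> Hf H; split=> // [|v y _].
- by apply: computes_succ; exact: computes_behead.
- by split=> [/H->|[_ [<-]]]; [exists 0 | apply/H].
Qed.

(** Finitely many arguments and the outer code each halt at some stage. Outputs persist at later
    stages, so the maximum of these stages serves all of them. *)
Lemma stage_evaluator_comp A f gs m Ef Eg :
  stage_evaluator A f (size gs) Ef ->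
  (forall i, stage_evaluator A (nth RZero gs i) m (Eg i)) ->
  stage_evaluator A (RComp f gs) m (fun t v =>
    if all (fun i => Eg i t v != 0) (iota 0 (size gs))
    then Ef t (mkseq (fun i => (Eg i t v).-1) (size gs)) else 0).
Proof.
move=> [cf mf Hf] HE.
have HEi i : computes A m.+1 (fun w => Eg i (arg w 0) (behead w)).
  by have [] := HE i.
have mg i t t' v : t <= t' -> Eg i t v != 0 -> Eg i t' v = Eg i t v.
  by have [_ + _] := HE i; apply.
have allP t v : reflect (forall i, i < size gs -> Eg i t v != 0)
    (all (fun i => Eg i t v != 0) (iota 0 (size gs))).
  by apply: (iffP allP) => H i Hi; apply: H; move: Hi; rewrite mem_iota.
split=> [|t t' v tt'|v y sz].
- apply: computes_if; last exact: computes_const.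
    apply: (@computes_all_const A m.+1 (size gs)
      (fun i w => Eg i (arg w 0) (behead w) != 0)) => i.
    by apply: computes_negb; apply: computes_eq => //; exact: computes_const.
  apply: (@computes_app A m.+1 (size gs).+1 _ (fun w => arg w 0 ::
      mkseq (fun i => (Eg i (arg w 0) (behead w)).-1) (size gs)) cf).
  + by move=> w _ /=; rewrite size_mkseq.
  + move=> [_|i Hi]; first exact: computes_arg.
    apply: computes_ext (computes_pred (HEi i)) => w _ /=.
    by rewrite nth_mkseq.
- case: (allP t v) => // Ht Ef0; case: (allP t' v) => [_|Ht']; last first.
    by case: Ht' => i Hi; rewrite (mg _ _ _ _ tt') //; exact: Ht.
  rewrite -(mf _ _ _ tt' Ef0); congr Ef; apply/eq_in_map => i; rewrite mem_iota => Hi.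
  by rewrite (mg _ _ _ _ tt') // Ht.
- split=> [/reval_comp[ws [szws Hws fy]]|[t]].
    have [t0 Ht0] : exists t, forall t', t <= t' -> forall i, i < size gs ->
        Eg i t' v = (arg ws i).+1.
      apply: eventually_all => i Hi; have [_ _ H] := HE i.
      have [t Et] := (H v _ sz).1 (Hws _ Hi).
      by exists t => t' tt'; rewrite (mg i t t') ?Et.
    have [u Eu] := (Hf _ _ szws).1 fy.
    have E := Ht0 (maxn t0 u) (leq_maxl _ _).
    exists (maxn t0 u); rewrite ifT; last by apply/allP => i /E ->.
    rewrite -Eu; have -> : mkseq (fun i => (Eg i (maxn t0 u) v).-1) (size gs) = ws.
      apply: (@eq_from_nth _ 0); rewrite size_mkseq // => i Hi.
      by rewrite nth_mkseq // E.
    by apply: mf; rewrite ?leq_maxr ?Eu.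
  case: allP => // Ht Ey; apply/reval_comp.
  exists (mkseq (fun i => (Eg i t v).-1) (size gs)); rewrite size_mkseq; split=> //.
  + move=> i Hi; have [_ _ H] := HE i; apply/H => //; exists t.
    by rewrite nth_mkseq // prednK // lt0n; exact: Ht.
  + by apply/Hf; [rewrite size_mkseq|exists t; exact: Ey].
Qed.

(** All steps of the recursion run at the same stage, and a step that has not halted passes its 0
    on. The arity [m.-1] is the length of [behead v], also for [m = 0]. *)
Lemma stage_evaluator_prec A f g m Ef Eg :
  stage_evaluator A f m.-1 Ef -> stage_evaluator A g m.-1.+2 Eg ->
  stage_evaluator A (RPrec f g) m (fun t v =>
    iteri (arg v 0) (fun i r => if r == 0 then 0 else Eg t [:: r.-1, i & behead v])
      (Ef t (behead v))).
Proof.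
move=> [cf mf Hf] [cg mg Hg].
pose rec t v n := iteri n (fun i r => if r == 0 then 0 else Eg t [:: r.-1, i & behead v])
  (Ef t (behead v)).
have recS t v n : rec t v n.+1 =
    if rec t v n == 0 then 0 else Eg t [:: (rec t v n).-1, n & behead v] by [].
have mrec t t' v n : t <= t' -> rec t v n != 0 -> rec t' v n = rec t v n.
  move=> tt'; elim: n => [|n IH]; first exact: mf.
  rewrite !recS; have [//|r0] := eqVneq (rec t v n) 0.
  by rewrite IH // (negPf r0); exact: mg.
split=> [|t t' v tt'|v y sz].
- pose G r i (w : seq nat) :=
    if r == 0 then 0 else Eg (arg w 0) [:: r.-1, i & behead (behead w)].
  apply: (@computes_iteri A m.+1 (fun w => arg (behead w) 0)
    (fun w => Ef (arg w 0) (behead (behead w))) G).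
  + exact: (@computes_behead A m (fun w => arg w 0) (computes_arg _ _ _)).
  + apply: (@computes_app A m.+1 m.-1.+1 _ (fun w => arg w 0 :: behead (behead w)) cf).
      by move=> w sz /=; rewrite !size_behead sz.
    move=> [|i] _; first exact: computes_arg.
    apply: computes_ext (computes_arg A _ i.+2) => w _ /=.
    by rewrite !nth_behead.
  + apply: computes_if; [|exact: computes_const|].
      by apply: computes_eq; [exact: computes_arg|exact: computes_const].
    apply: (@computes_app A m.+3 m.-1.+3 _
      (fun w => [:: arg (behead (behead w)) 0, (arg w 0).-1, arg w 1 &
         behead (behead (behead (behead w)))]) cg).
      by move=> w sz /=; rewrite !size_behead sz.
    move=> [|[|[|i]]] _; [|exact: (computes_pred (computes_arg _ _ 0))|exact: computes_arg|].
      by apply: computes_ext (computes_arg A _ 2) => w _ /=; rewrite !nth_behead.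
    apply: computes_ext (computes_arg A _ i.+4) => w _ /=.
    by rewrite !nth_behead.
- exact: mrec.
- have szb : size (behead v) = m.-1 by rewrite size_behead sz.
  move=> /=; elim: (arg v 0) y => [|n IH] y /=; first exact: Hf.
  split=> [[w [/IH[t Et] gw]]|[t]].
    have [//|u Eu] := (Hg [:: w, n & behead v] y _).1 gw; first by rewrite /= szb.
    exists (maxn t u); apply: etrans (recS _ _ _) _; rewrite (mrec t) ?leq_maxl // /rec Et //=.
    by rewrite -Eu; apply: mg; rewrite ?leq_maxr ?Eu.
  move=> /(etrans (esym (recS _ _ _))).
  have [//|r0 Ey] := eqVneq (rec t v n) 0.
  exists (rec t v n).-1; split; first by apply/IH; exists t; rewrite prednK // lt0n.
  by apply/Hg; [rewrite /= szb|exists t].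
Qed.

(** The value 1 of [Ef] stands for output 0 and larger values for nonzero outputs. At most one [y]
    can therefore have value 1 with larger values at all smaller arguments, and the sum merely
    selects it. The bound [y < t] keeps the search finite. *)
Lemma stage_evaluator_min A f m Ef :
  stage_evaluator A f m.+1 Ef ->
  stage_evaluator A (RMin f) m (fun t v => \sum_(y < t)
    if (Ef t (val y :: v) == 1) && all (fun k => 1 < Ef t (k :: v)) (iota 0 y)
    then y.+1 else 0).
Proof.
move=> [cf mf Hf].
pose found t v y := (Ef t (y :: v) == 1) && all (fun k => 1 < Ef t (k :: v)) (iota 0 y).
have foundP t v y : reflect (Ef t (y :: v) = 1 /\ forall k, k < y -> 1 < Ef t (k :: v))
    (found t v y).
  apply: (iffP andP) => [[/eqP E /allP H]|[E H]]; rewrite ?E; split=> //.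
    by move=> k Hk; apply: H; rewrite mem_iota.
  by apply/allP => k; rewrite mem_iota; exact: H.
have sumP t v y : \sum_(y < t) (if found t v y then y.+1 else 0) = y.+1 <->
    y < t /\ found t v y.
  have E y' : y' < t -> found t v y' ->
      \sum_(y < t) (if found t v y then y.+1 else 0) = y'.+1.
    move=> yt Hy; rewrite (bigD1 (Ordinal yt)) //= Hy big1 ?addn0 // => -[i it] /= ine.
    case: (foundP t v i) => // -[Ei Hi]; have /foundP[Ey' Hy'] := Hy.
    by rewrite -val_eqE /= in ine; case: (ltngtP i y') ine => [/Hy'|/Hi|]; rewrite ?Ei ?Ey'.
  split=> [Es|[]]; last exact: E.
  have [[i Hi] /= H|H] := pickP (fun i : 'I_t => found t v i).
    by have := E _ Hi H; rewrite Es => -[->].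
  by move: Es; rewrite big1 // => i _; rewrite H.
have mfound t t' v y : t <= t' -> found t v y -> found t' v y.
  move=> tt' /foundP[Ey Hy]; apply/foundP; split; first by rewrite (mf t) ?Ey.
  by move=> k /Hy Hk; rewrite (mf t) //; lia.
split=> [|t t' v tt'|v y sz].
- apply: (@computes_sum A m.+1 (fun w => arg w 0)
    (fun y w => if found (arg w 0) (behead w) y then y.+1 else 0)).
    exact: computes_arg.
  (* In front of the stage and [v], the list [w] holds [n] bound variables: [y] alone for [n = 1],
     then [k] and [y] for [n = 2]. *)
  have cEf n (a b : seq nat -> nat) : computes A (n + m.+1) a ->
      computes A (n + m.+1) b ->
      computes A (n + m.+1) (fun w => Ef (a w) (b w :: behead (drop n w))).
    move=> Ha Hb; apply: (@computes_app A (n + m.+1) m.+2 _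
      (fun w => [:: a w, b w & behead (drop n w)]) cf) => [w szw|[|[|i]] _] //=.
      by rewrite size_behead size_drop szw addKn.
    apply: computes_ext (computes_arg A _ (n + i.+1)) => w _ /=.
    by rewrite nth_behead nth_drop.
  apply: computes_if; [|exact/computes_succ/computes_arg|exact: computes_const].
  apply: computes_and.
    apply: computes_eq; last exact: computes_const.
    have := cEf 1 _ _ (computes_arg A _ 1) (computes_arg A _ 0).
    by apply: computes_ext => w _; rewrite drop1 nth_behead.
  apply: (@computes_all A m.+2 (fun w => arg w 0)
    (fun k w => 1 < Ef (arg (behead w) 0) (k :: behead (behead w)))).
    exact: computes_arg.
  apply: computes_leq; first exact: computes_const.
  have := cEf 2 _ _ (computes_arg A _ 2) (computes_arg A _ 0).
  by apply: computes_ext => w _; rewrite -drop1 !nth_behead -!drop1 !drop_drop.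
- rewrite -lt0n => /prednK/esym E; rewrite [RHS]E; apply/sumP.
  move/sumP: E => [yt Hy]; split; first exact: leq_trans yt tt'.
  exact: mfound Hy.
- have iffE t : found t v y -> reval A (RMin f) v y.
    move=> /foundP[Ey Hy]; split; first by apply/Hf; [rewrite /= sz|exists t].
    move=> k /Hy Hk; exists (Ef t (k :: v)).-2; apply/Hf; first by rewrite /= sz.
    by exists t; lia.
  split=> [[fy Hy]|[t /sumP[_ /iffE]]] //.
  have [|t0 Ht0] := @eventually_all (fun k t => 1 < Ef t (k :: v)) y.
    move=> k /Hy[w /Hf[|t Et]]; first by rewrite /= sz.
    by exists t => t' tt'; rewrite (mf t) ?Et.
  have [|u Eu] := (Hf (y :: v) _ _).1 fy; first by rewrite /= sz.
  exists (maxn (maxn t0 u) y.+1); apply/sumP; split; first exact: leq_maxr.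
  apply/foundP; split; first by rewrite (mf u) ?Eu //; lia.
  by apply: Ht0; lia.
Qed.

Lemma stage_evaluator_exists A c m : exists E, stage_evaluator A c m E.
Proof.
elim/rcode_nested_ind: c m => [||i||f gs IHf IHgs|f g IHf IHg|f IHf] m.
- exists (fun _ _ => 1); exact: (stage_evaluator_total (computes_const _ _ 0)).
- eexists; apply: (@stage_evaluator_total A RSucc m (fun v => (arg v 0).+1)) => //.
  exact/computes_succ/computes_arg.
- eexists; apply: (@stage_evaluator_total A (RProj i) m (fun v => arg v i)) => //.
  exact: computes_arg.
- eexists; apply: (@stage_evaluator_total A ROracle m (fun v => A (arg v 0) : nat)) => //.
  exact/computes_oracle/computes_arg.
- have [Ef Hf] := IHf (size gs); have /choice[Eg Hg] := IHgs ^~ m.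
  by eexists; exact: (stage_evaluator_comp Hf Hg).
- have [Ef Hf] := IHf m.-1; have [Eg Hg] := IHg m.-1.+2.
  by eexists; exact: stage_evaluator_prec Hf Hg.
- have [Ef Hf] := IHf m.+1.
  by eexists; exact: stage_evaluator_min Hf.
Qed.

End StepEvaluation.

(** * Arithmetic of string codes, the tree and the test *)

Section StringCodes.
Local Open Scope nat_scope.
Set Implicit Arguments.
Unset Strict Implicit.

Local Notation arg v i := (nth 0 v i).

(** In bijective base 2, least significant digit first, removing the first digit sends x to half of
    x - 1, rounded down. The length is the number of i for which i removals leave something; the
    bound x suffices as a string is no longer than its code. Position i has weight [2 ^ i], which
    explains [code_take]. *)
Definition code_drop i x := iter i (fun y => y.-1./2) x.
Definition code_size x := \sum_(i < x) (0 < code_drop i x).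
Definition code_bit i x := odd (code_drop i x).-1.
Definition code_take i x := x - 2 ^ i * code_drop i x.

Lemma code_dropE i s : code_drop i (code_str s) = code_str (drop i s).
Proof.
rewrite /code_drop; elim: i s => [|i IH] s; first by rewrite drop0.
rewrite iterSr; case: s => [|b s] /=; first by rewrite (IH [::]).
by rewrite addnC half_bit_double IH.
Qed.

Lemma code_str_gt0 s : (0 < code_str s) = (0 < size s).
Proof. by case: s. Qed.

Lemma size_code_str s : size s <= code_str s.
Proof. by elim: s => //= b s IH; lia. Qed.

Lemma code_sizeE s : code_size (code_str s) = size s.
Proof.
rewrite /code_size; under eq_bigr => i _ do rewrite code_dropE code_str_gt0 size_drop subn_gt0.
have := size_code_str s; move: (code_str s) (size s) => n m mn.
transitivity (\sum_(i < n | i < m) 1); first by rewrite [RHS]big_mkcond; apply: eq_bigr.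
by rewrite -(big_ord_widen _ (fun=> 1)) // sum1_card card_ord.
Qed.

Lemma code_bitE i s : code_bit i (code_str s) = nth false s i.
Proof.
rewrite /code_bit code_dropE -[i in RHS]addn0 -nth_drop.
by case: (drop i s) => //= -[] t; rewrite ?addn0 ?addn1 /= odd_double.
Qed.

Lemma code_takeE i s : code_take i (code_str s) = code_str (take i s).
Proof.
suff E : code_str s = code_str (take i s) + 2 ^ i * code_str (drop i s).
  by rewrite /code_take code_dropE {1}E addnK.
elim: s i => [|b s IH] [|i] //=; rewrite ?muln0 ?mul1n //.
by rewrite [in LHS](IH i) expnS; lia.
Qed.

Definition str_of_code x := mkseq (code_bit^~ x) (code_size x).

Lemma code_strK : cancel code_str str_of_code.
Proof.
move=> s; rewrite /str_of_code code_sizeE.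
apply: (@eq_from_nth _ false); rewrite size_mkseq // => i Hi.
by rewrite nth_mkseq // code_bitE.
Qed.

Lemma str_of_codeK : cancel str_of_code code_str.
Proof.
suff H x : exists s, code_str s = x by move=> x; have [s <-] := H x; rewrite code_strK.
elim/ltn_ind: x => -[|x] IH; first by exists [::].
have [|s Hs] := IH x./2; first by rewrite ltnS; lia.
by exists (odd x :: s); rewrite /= Hs addnC odd_double_half.
Qed.

Lemma size_str_of_code x : size (str_of_code x) = code_size x.
Proof. exact: size_mkseq. Qed.

(** Whether s is in the tree depends on the bits at its proper prefixes only, hence on bits below
    the code of s. *)
Lemma code_take_lt i s : i < size s -> code_str (take i s) < code_str s.
Proof.
elim: s i => [|b s IH] [|i] //=; rewrite ltnS => /IH; rewrite !ltnS; lia.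
Qed.

(** This is the independence of the constraints that s has to meet. *)
Lemma code_take_inj s : {in gtn (size s) &, injective (fun i => code_str (take i s))}.
Proof.
move=> i j; rewrite !inE => Hi Hj /(can_inj code_strK)/(congr1 size).
by rewrite !size_takel // ltnW.
Qed.

Section Computable.
Variables (A : nat -> bool) (m : nat).

Lemma computes_code_drop i x : computes A m i -> computes A m x ->
  computes A m (fun v => code_drop (i v) (x v)).
Proof.
move=> Hi Hx.
have := @computes_iteri A m i x (fun r _ _ => r.-1./2) Hi Hx
  (computes_half (computes_pred (computes_arg _ _ _))).
apply: computes_ext => v _; rewrite /code_drop.
by elim: (i v) => //= n ->.
Qed.

Lemma computes_code_bit i x : computes A m i -> computes A m x ->
  computes A m (fun v => code_bit (i v) (x v) : nat).
Proof. by move=> Hi Hx; apply/computes_odd/computes_pred/computes_code_drop. Qed.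

Lemma computes_code_take i x : computes A m i -> computes A m x ->
  computes A m (fun v => code_take (i v) (x v)).
Proof.
move=> Hi Hx; apply: computes_sub => //; apply: computes_mul; first exact: computes_exp2.
exact: computes_code_drop.
Qed.
End Computable.

Lemma computes_code_size A m x : computes A m x ->
  computes A m (fun v => code_size (x v)).
Proof.
move=> Hx; apply: (@computes_sum A m x (fun i v => 0 < code_drop i (x v))) => //.
apply: computes_leq; first exact: computes_const.
by apply: computes_code_drop; [exact: computes_arg|exact: (computes_behead Hx)].
Qed.

Definition in_tree (g : nat -> nat) (z : nat -> bool) (s : bitseq) :=
  all (fun i => (g i.+1 != g i) || (nth false s i == z (code_str (take i s))))
    (iota 0 (size s)).

Lemma in_treeE g z x : in_tree g z (str_of_code x) =
  all (fun i => (g i.+1 != g i) || (code_bit i x == z (code_take i x)))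
    (iota 0 (code_size x)).
Proof.
rewrite -{2 3 4}(str_of_codeK x) code_sizeE /in_tree.
by apply: eq_all => i; rewrite code_bitE code_takeE.
Qed.

Lemma eqb_nat (b c : bool) : (b == c) = (b == c :> nat).
Proof. by case: b; case: c. Qed.

(** The bits are a parameter: taken from the oracle, they give the tree computed by z; taken from
    the code of a string, they give the test. *)
Lemma computes_in_tree A m g (Z : nat -> seq nat -> bool) Y : computable_fun g ->
  computes A m.+1 (fun w => Z (arg w 0) (behead w) : nat) -> computes A m Y ->
  computes A m (fun v => in_tree g (Z^~ v) (str_of_code (Y v)) : nat).
Proof.
move=> Hg HZ HY; under eq_fun do rewrite in_treeE.
apply: (@computes_all A m (fun v => code_size (Y v)) (fun i v =>
  (g i.+1 != g i) || (code_bit i (Y v) == Z (code_take i (Y v)) v))).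
  exact: computes_code_size.
have H0 := computes_arg A m.+1 0.
have HY' := computes_behead HY.
apply: computes_or.
  apply/computes_negb/computes_eq; apply: computes_fun => //; exact: computes_succ.
under eq_fun do rewrite eqb_nat.
apply: computes_eq; first exact: computes_code_bit.
apply: (@computes_app A m.+1 m.+1 _ (fun w =>
  code_take (arg w 0) (Y (behead w)) :: behead w) HZ) => [v|[|i] _] /=.
- by rewrite size_behead => ->.
- exact: computes_code_take.
- apply: computes_ext (computes_arg A _ i.+1) => w _.
  by rewrite nth_behead.
Qed.

Lemma in_tree_computable g z : computable_fun g -> computes_strset z (in_tree g z).
Proof.
move=> Hg; have [|c Hc] := @computes_in_tree z 1 g (fun a _ => z a) (fun v => arg v 0) Hg _
  (computes_arg _ _ _).
  exact/computes_oracle/computes_arg.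
by exists c => s; have := Hc [:: code_str s] erefl; rewrite /= code_strK.
Qed.

Definition mass_term g (E : nat -> seq nat -> nat) L (X : nat -> bool) q :=
  let e := E L [:: q] in
  if [&& e != 0, e.-1 <= L & in_tree g X (str_of_code e.-1)]
  then 2 ^ (L - code_size q + (code_size e.-1 - g (code_size e.-1))) else 0.

(* [2 ^ L] times the stage [L] approximation to the sum over the programs [p]
   whose output [s] is in the tree of [X] of [2 ^ (|s| - g |s| - |p|)].  The
   condition [e.-1 <= L] on the code of [s] ensures that the bits of [X] below [L]
   decide whether [s] is in the tree. *)
Definition mass g E L (X : nat -> bool) := \sum_(q < L) mass_term g E L X q.

(** The string is used as the beginning of the oracle and its length as the stage. Up to the scaling
    by [2 ^ size s], the condition is that the sum has reached [2 ^ k]. *)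
Definition mass_test g E k : set bitseq :=
  [set s | 2 ^ (k + size s) <= mass g E (size s) (nth false s)].

Lemma mass_test_ce g E : computable_fun g ->
  computes no_oracle 2 (fun w => E (arg w 0) (behead w)) ->
  uniformly_ce (mass_test g E).
Proof.
move=> Hg HE.
have Hpair m a b : computes no_oracle m a -> computes no_oracle m b ->
    computes no_oracle m (fun v => E (a v) [:: b v]).
  move=> Ha Hb; apply: (@computes_app _ m 2 _ (fun v => [:: a v; b v]) HE) => //.
  by move=> [|[|]].
have Hsize m i : computes no_oracle m (fun w => code_size (arg w i)).
  exact/computes_code_size/computes_arg.
have [c Hc] : computes no_oracle 3 (fun w => ~~ (2 ^ (arg w 1 + code_size (arg w 2)) <=
    mass g E (code_size (arg w 2)) (code_bit^~ (arg w 2))) : nat).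
  apply/computes_negb/computes_leq.
    by apply/computes_exp2/computes_add => //; exact: computes_arg.
  apply: (@computes_sum no_oracle 3 (fun w => code_size (arg w 2)) (fun q w =>
    mass_term g E (code_size (arg w 2)) (code_bit^~ (arg w 2)) q)) => //.
  rewrite /mass_term /=.
  have HL : computes no_oracle 4 (fun w => code_size (arg (behead w) 2)).
    exact/(computes_behead (Hsize 3 2)).
  have He := Hpair 4 _ _ HL (computes_arg _ _ 0).
  have He1 := computes_pred He.
  have Hs := computes_code_size He1.
  apply: computes_if; last exact: computes_const; last first.
    apply/computes_exp2/computes_add; apply: computes_sub => //.
    exact: computes_fun.
  apply: computes_and; first by apply/computes_negb/computes_eq => //; exact: computes_const.
  apply: computes_and; first exact: computes_leq.
  apply: (@computes_in_tree no_oracle 4 g (fun a w => code_bit a (arg (behead w) 2))) => //.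
  apply: computes_code_bit; first exact: computes_arg.
  exact: (@computes_behead _ 4 (fun w => arg (behead w) 2)
           (@computes_behead _ 3 (fun w => arg w 2) (computes_arg _ _ _))).
(* The code [c] ignores the search variable, so the search stops at 0 if the decidable condition
   holds and never otherwise. *)
exists (RMin c) => k s.
have {}Hc y := Hc [:: y; k; code_str s] erefl.
have E1 : mass g E (size s) (code_bit^~ (code_str s)) = mass g E (size s) (nth false s).
  by congr mass; apply/funext => i; rewrite code_bitE.
rewrite /= code_sizeE E1 in Hc; rewrite /mass_test /=.
split=> [H|[y []] /(reval_fun (Hc _))].
  by exists 0; split=> //; have := Hc 0; rewrite H.
by case: leqP.
Qed.

End StringCodes.

(** * Counting bit assignments: Kraft's inequality, expectation and Markov bound *)

Section Counting.
Local Open Scope nat_scope.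
Set Implicit Arguments.
Unset Strict Implicit.

(** The [2 ^ L] functions play the part of a probability space for the bits below [L]; padding with
    [false] makes each of them usable as an oracle. *)
Definition ffun_seq L (x : {ffun 'I_L -> bool}) (a : nat) : bool :=
  if insub a is Some i then x i else false.

Lemma ffun_seqE L (x : {ffun 'I_L -> bool}) (i : 'I_L) : ffun_seq x i = x i.
Proof. by rewrite /ffun_seq valK. Qed.

Lemma card_prescribed L (r : seq nat) (b : nat -> bool) :
  uniq r -> {in r, forall a, a < L} ->
  #|[pred x : {ffun 'I_L -> bool} | all (fun a => ffun_seq x a == b a) r]|
    = 2 ^ (L - size r).
Proof.
move=> Ur rL.
pose F (i : 'I_L) : {pred bool} := if val i \in r then pred1 (b i) else predT.
have -> : #|[pred x : {ffun 'I_L -> bool} | all (fun a => ffun_seq x a == b a) r]|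
    = #|family F|.
  apply: eq_card => x; apply/allP/familyP => H.
    by move=> i; rewrite /F; case: ifP => // /H; rewrite ffun_seqE.
  move=> a ar; have := H (Ordinal (rL a ar)).
  by rewrite /F /= ar -topredE /= -ffun_seqE.
rewrite card_family.
have -> : foldr muln 1 [seq #|F i| | i : 'I_L] = \prod_(i : 'I_L | val i \notin r) 2.
  rewrite foldrE big_image [RHS]big_mkcond; apply: eq_bigr => i _.
  rewrite /F; case: (val i \in r) => /=; first exact: card1.
  exact: card_bool.
rewrite prod_nat_const; congr (2 ^ _).
rewrite -[L in RHS]card_ord -(cardC [pred i : 'I_L | val i \in r]).
suff -> : #|[pred i : 'I_L | val i \in r]| = size r by rewrite addKn; apply: eq_card.
have -> : size r = size (pmap insub r : seq 'I_L).
  rewrite size_pmap_sub; apply/esym/eqP; rewrite -all_count; apply/allP => a; exact: rL.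
rewrite -(card_uniqP (pmap_sub_uniq _ Ur)).
by apply: eq_card => i; rewrite mem_pmap_sub.
Qed.

Lemma mkseq_eqE (X : nat -> bool) s :
  (mkseq X (size s) == s) = all (fun i => X i == nth false s i) (iota 0 (size s)).
Proof.
apply/eqP/allP => [<- i|H].
  by rewrite mem_iota size_mkseq => Hi; rewrite nth_mkseq.
apply: (@eq_from_nth _ false); rewrite size_mkseq // => i Hi.
by rewrite nth_mkseq //; apply/eqP/H; rewrite mem_iota.
Qed.

Lemma card_cylinder L s : size s <= L ->
  #|[pred x : {ffun 'I_L -> bool} | mkseq (ffun_seq x) (size s) == s]| = 2 ^ (L - size s).
Proof.
move=> sL; rewrite -[size s in RHS](size_iota 0).
rewrite -(@card_prescribed L (iota 0 (size s)) (nth false s)) ?iota_uniq //.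
  by apply: eq_card => x; rewrite -!topredE /= mkseq_eqE.
by move=> a; rewrite mem_iota => /leq_trans; apply.
Qed.

Lemma prefix_mkseq (X : nat -> bool) m n : m <= n -> prefix (mkseq X m) (mkseq X n).
Proof. by move=> mn; rewrite prefixE size_mkseq /mkseq -map_take take_iota (minn_idPl mn). Qed.

(** Double counting: prefix-freeness puts each assignment into at most one cylinder. The set [P] is
    everything when S consists of programs, and the class of the test when its measure is
    bounded. *)
Lemma kraft L (S : seq bitseq) (P : pred {ffun 'I_L -> bool}) :
  uniq S -> {in S &, forall s t, prefix s t -> s = t} ->
  {in S, forall s, size s <= L} ->
  (forall s x, s \in S -> mkseq (ffun_seq x) (size s) = s -> P x) ->
  \sum_(s <- S) 2 ^ (L - size s) <= #|P|.
Proof.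
move=> US pfS SL SP.
have -> : \sum_(s <- S) 2 ^ (L - size s) =
    \sum_(s <- S) \sum_(x : {ffun 'I_L -> bool}) (mkseq (ffun_seq x) (size s) == s).
  apply: eq_big_seq => s sS; rewrite -card_cylinder ?SL // -sum1_card.
  by rewrite big_mkcond; apply: eq_bigr => x _; rewrite -topredE /=; case: eqP.
rewrite exchange_big /= -sum1_card [leqRHS]big_mkcond /=.
apply: leq_sum => x _.
have [/hasP[s sS /eqP xs]|/hasPn Hx] := boolP (has (fun s => mkseq (ffun_seq x) (size s) == s) S).
  have -> : x \in P by exact: SP sS xs.
  rewrite (bigD1_seq s) //= xs eqxx big_seq_cond big1 // => t /andP[tS ts].
  case: eqP => // xt; case/negP: ts; apply/eqP.
  case/orP: (leq_total (size t) (size s)) => /(prefix_mkseq (ffun_seq x)); rewrite xs xt.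
    exact: pfS.
  by move=> /pfS->.
by rewrite big_seq big1 // => s /Hx /negPf ->.
Qed.

Section Mass.
Variable g : nat -> nat.
Hypotheses (g_mono : {homo g : m n / m <= n}) (g0 : g 0 = 0).
Hypothesis g_step : forall n, g n.+1 <= g n + 1.

Lemma count_constant_steps n :
  count (fun i => g i.+1 == g i) (iota 0 n) = n - g n.
Proof.
suff : g n + count (fun i => g i.+1 == g i) (iota 0 n) = n by lia.
elim: n => [|n IH]; first by rewrite g0.
rewrite -[in iota _ _]addn1 iotaD count_cat add0n /=.
have := g_mono (leqnSn n); have := g_step n; case: eqP => /= ?; lia.
Qed.

Lemma g_le n : g n <= n.
Proof. by elim: n => [|n IH]; [rewrite g0 | have := g_step n; lia]. Qed.

Lemma card_in_tree L s : code_str s <= L ->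
  #|[pred x : {ffun 'I_L -> bool} | in_tree g (ffun_seq x) s]|
    = 2 ^ (L - (size s - g (size s))).
Proof.
move=> sL.
pose r := [seq code_str (take i s) | i <- iota 0 (size s) & g i.+1 == g i].
have -> : size s - g (size s) = size r.
  by rewrite size_map size_filter count_constant_steps.
(* The prescribed value has to be a function of the address [a]; the level is recovered as the
   length of the string coded by [a]. *)
rewrite -(@card_prescribed L r (fun a => nth false s (code_size a))).
- apply: eq_card => x; rewrite -!topredE /= /in_tree all_map all_filter.
  apply: eq_in_all => i; rewrite mem_iota /= => Hi.
  by rewrite code_sizeE size_takel 1?ltnW // implybE [nth _ _ _ == _]eq_sym.
- rewrite map_inj_in_uniq ?filter_uniq ?iota_uniq // => i j.
  by rewrite !mem_filter !mem_iota => /andP[_ Hi] /andP[_ Hj]; exact: code_take_inj.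
- move=> _ /mapP[i + ->]; rewrite mem_filter mem_iota => /andP[_ Hi].
  exact: leq_trans (code_take_lt Hi) sL.
Qed.

Lemma in_tree_agree X Y L s : {in gtn L, X =1 Y} -> code_str s <= L ->
  in_tree g X s = in_tree g Y s.
Proof.
move=> XY sL; apply: eq_in_all => i; rewrite mem_iota => Hi.
by rewrite XY // inE (leq_trans (code_take_lt Hi) sL).
Qed.

Variable E : nat -> seq nat -> nat.
Hypothesis E_mono : forall t t' v, t <= t' -> E t v != 0 -> E t' v = E t v.
Hypothesis E_prefix_free : forall t p q, E t [:: code_str p] != 0 ->
  E t [:: code_str q] != 0 -> prefix p q -> p = q.

Lemma mass_agree X Y L : {in gtn L, X =1 Y} -> mass g E L X = mass g E L Y.
Proof.
move=> XY; apply: eq_bigr => q _; rewrite /mass_term /=; case: eqP => //= _; case: leqP => //= eL.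
by rewrite (in_tree_agree XY) // str_of_codeK.
Qed.

Lemma code_size_le q : code_size q <= q.
Proof. by rewrite -{1}(str_of_codeK q) code_sizeE -{2}(str_of_codeK q) size_code_str. Qed.

(** A program that counts at stage [L] keeps its output, so its term is scaled by exactly
    [2 ^ (L' - L)]; further programs only add to the sum. *)
Lemma mass_mono X L L' : L <= L' -> 2 ^ (L' - L) * mass g E L X <= mass g E L' X.
Proof.
move=> LL'; rewrite /mass (big_ord_widen _ (mass_term g E L X) LL') big_mkcond big_distrr /=.
apply: leq_sum => q _; case: ifP => [qL|]; last by rewrite muln0.
rewrite /mass_term /=; case: ifP => [|_]; last by rewrite muln0.
case/and3P=> e0 eL eT; rewrite (E_mono LL' e0) e0 (leq_trans eL LL') eT /=.
rewrite -expnD leq_exp2l //; have := code_size_le q; lia.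
Qed.

(** One factor [2 ^ L] counts the assignments, the other is the scaling of [mass]: the expectation
    is at most 1. For a program with output s and d = |s| - g |s|, the chance 2 ^ -d that s is in
    the tree cancels the weight 2 ^ d, and the Kraft sum of the halted programs remains. *)
Lemma sum_mass_le L :
  \sum_(x : {ffun 'I_L -> bool}) mass g E L (ffun_seq x) <= 2 ^ L * 2 ^ L.
Proof.
rewrite exchange_big /=.
pose S := [seq str_of_code q | q <- iota 0 L & E L [:: q] != 0].
have HS : \sum_(s <- S) 2 ^ (L - size s) <= 2 ^ L.
  apply: leq_trans (@kraft L S predT _ _ _ _) _ => //.
  - rewrite map_inj_uniq ?filter_uniq ?iota_uniq //; exact: can_inj str_of_codeK.
  - move=> _ _ /mapP[p + ->] /mapP[q + ->]; rewrite !mem_filter => /andP[Hp _] /andP[Hq _].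
    by apply: (E_prefix_free (t := L)); rewrite str_of_codeK.
  - move=> _ /mapP[q + ->]; rewrite mem_filter mem_iota add0n => /andP[_ /ltnW qL].
    rewrite size_str_of_code; exact: leq_trans (code_size_le q) qL.
  - by rewrite cardT -cardE card_ffun card_bool card_ord.
apply: leq_trans (_ : \sum_(q < L) (if E L [:: val q] != 0 then 2 ^ (L - code_size q) else 0)
    * 2 ^ L <= _); last first.
  rewrite -big_distrl leq_mul2r; apply/orP; right; apply: leq_trans HS.
  rewrite /S big_map big_filter -big_mkcond /= -(big_mkord (fun q => E L [:: q] != 0)
    (fun q => 2 ^ (L - code_size q))) /index_iota subn0.
  by apply/eq_leq/eq_bigr => q _; rewrite size_str_of_code.
apply: leq_sum => q _; rewrite /mass_term /=.
have [e0|_] := eqVneq (E L [:: val q]) 0; first by rewrite big1.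
case: (leqP (E L [:: val q]).-1 L) => /= eL; last by rewrite big1.
set s := str_of_code _; set d := _ - g _.
rewrite -big_mkcond sum_nat_const (@card_in_tree L s) ?str_of_codeK //.
rewrite size_str_of_code -/d expnD mulnC -mulnA leq_mul2l; apply/orP; right.
rewrite -expnD leq_exp2l // subnKC // (leq_trans (leq_subr _ _)) //.
exact: leq_trans (code_size_le _) eL.
Qed.

Lemma card_mass_test k L :
  #|[pred x : {ffun 'I_L -> bool} | 2 ^ (k + L) <= mass g E L (ffun_seq x)]| * 2 ^ k
    <= 2 ^ L.
Proof.
rewrite -(leq_pmul2r (expn_gt0 2 L)) -mulnA -expnD.
apply: leq_trans (sum_mass_le L); rewrite -sum_nat_const.
rewrite [leqRHS](bigID [pred x | 2 ^ (k + L) <= mass g E L (ffun_seq x)]) /=.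
by apply: leq_trans (leq_addr _ _); apply: leq_sum.
Qed.

Lemma mass_testE k X L :
  mass_test g E k (mkseq X L) <-> 2 ^ (k + L) <= mass g E L X.
Proof.
rewrite /mass_test /= size_mkseq (@mass_agree _ X) // => a aL.
by rewrite nth_mkseq.
Qed.

Lemma mass_test_mono k X L L' : L <= L' ->
  mass_test g E k (mkseq X L) -> mass_test g E k (mkseq X L').
Proof.
move=> LL' /mass_testE H; apply/mass_testE.
apply: leq_trans (mass_mono X LL'); apply: leq_trans (leq_mul (leqnn _) H).
by rewrite -expnD leq_exp2l //; lia.
Qed.

End Mass.
End Counting.

(** * From counting at each length to the uniform measure *)

Section MeasureBound.
Set Implicit Arguments.
Unset Strict Implicit.

(** The prefix-minimal strings of [W] cover the same class and are prefix-free. A finite partial sum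
    over them involves strings of length at most some [L]; as [W] is closed under extension, Kraft's
    inequality at length [L] bounds the sum by the share of assignments whose string is in [W]. *)
Lemma uniform_measure_le (R : realType) (W : set bitseq) k :
  (forall X L L', (L <= L')%N -> W (mkseq X L) -> W (mkseq X L')) ->
  (forall L, #|[pred x : {ffun 'I_L -> bool} | `[< W (mkseq (ffun_seq x) L) >]]| * 2 ^ k
     <= 2 ^ L)%N ->
  (uniform_measure R (open_class W) <= ((2^-1 : R) ^+ k)%:E)%E.
Proof.
move=> Wmono Wcard.
pose D : set bitseq := [set s | W s /\ forall t, prefix t s -> W t -> t = s].
apply: ge_ereal_inf; exists (\esum_(s in D) ((2^-1 : R) ^+ size s)%:E).
  exists D => // X [s Ws Es].
  have exP : exists n, `[< W (mkseq X n) >] by exists (size s); apply/asboolP; rewrite -Es.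
  case: (ex_minnP exP) => n /asboolP Wn n_min.
  exists (mkseq X n); last by rewrite size_mkseq.
  split=> // t tn Wt.
  have st : (size t <= n)%N by have := size_prefix tn; rewrite size_mkseq.
  have Et : t = mkseq X (size t).
    move: tn; rewrite prefixE => /eqP {1}<-.
    by rewrite /mkseq -map_take take_iota (minn_idPl st).
  suff -> : n = size t by [].
  by apply/eqP; rewrite eqn_leq st andbT; apply/n_min/asboolP; rewrite -Et.
apply: ge_ereal_sup => _ [F [finF FD] <-].
have [S [SU FS]] : exists S : seq bitseq, uniq S /\ F = [set` S].
  have /finite_seqP[S FS] := finF.
  exists (undup S); split; first exact: undup_uniq.
  by rewrite FS; apply/seteqP; split=> s /=; rewrite mem_undup.
have SD s : s \in S -> D s by move=> sS; apply: FD; rewrite FS.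
rewrite FS -fsbig_seq //= sumEFin lee_fin.
pose L := (\max_(s <- S) size s)%N.
have SL s : s \in S -> (size s <= L)%N by move=> sS; rewrite /L (leq_bigmax_seq s).
have H : (\sum_(s <- S) 2 ^ (L - size s) <=
    #|[pred x : {ffun 'I_L -> bool} | `[< W (mkseq (ffun_seq x) L) >]]|)%N.
  apply: kraft => //.
  - by move=> s t /SD[Ws _] /SD[_ +] st; apply.
  - move=> s x sS xs; apply/asboolP; apply: Wmono (SL s sS) _.
    by rewrite xs; have [] := SD s sS.
have two0 n : (0 : R) < 2 ^+ n by rewrite exprn_gt0.
have -> : \sum_(s <- S) (2^-1 : R) ^+ size s =
    (\sum_(s <- S) 2 ^ (L - size s))%:R / 2 ^+ L.
  rewrite natr_sum mulr_suml; apply: eq_big_seq => s sS.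
  rewrite natrX exprB ?SL ?unitfE // mulrAC mulfV ?gt_eqF // mul1r.
  by rewrite exprVn.
rewrite ler_pdivrMr // exprVn mulrC ler_pdivlMr // -!natrX -natrM ler_nat.
by apply: leq_trans (Wcard L); rewrite leq_mul2r H orbT.
Qed.

End MeasureBound.

(** * Shape of the tree: extendibility, perfectness, size of the levels *)

Section Tree.
Local Open Scope nat_scope.
Set Implicit Arguments.
Unset Strict Implicit.

Variables (g : nat -> nat) (z : nat -> bool).
Hypotheses (g_order : order_fun g) (g0 : g 0 = 0).
Hypothesis g_step : forall n, g n.+1 <= g n + 1.

Local Notation T := (in_tree g z).

Lemma in_tree_rcons s b : T (rcons s b) =
  T s && ((g (size s).+1 != g (size s)) || (b == z (code_str s))).
Proof.
rewrite /in_tree size_rcons -[in iota _ _]addn1 iotaD all_cat add0n /= andbT.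
rewrite nth_rcons ltnn eqxx -cats1 take_size_cat //; congr (_ && _).
apply: eq_in_all => i; rewrite mem_iota add0n => /= Hi.
by rewrite nth_cat takel_cat ?Hi // ltnW.
Qed.

Lemma in_tree_prefix s t : T t -> prefix s t -> T s.
Proof.
move=> + /prefixP[u Et]; rewrite {t}Et.
elim/last_ind: u => [|u b IH]; first by rewrite cats0.
by rewrite -rcons_cat in_tree_rcons => /andP[/IH].
Qed.

Lemma in_tree_extend s n : T s -> size s <= n ->
  exists t, [/\ T t, prefix s t & size t = n].
Proof.
move=> Ts; elim: n => [|n IH]; first by rewrite leqn0 => /eqP s0; exists s; rewrite prefix_refl s0.
rewrite leq_eqVlt => /predU1P[Es|]; first by exists s; rewrite prefix_refl Es.
(* The child given by the bit of z is in the tree at branching levels as well, so no case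
   distinction arises. *)
move=> /IH[t [Tt st Et]]; exists (rcons t (z (code_str t))).
rewrite in_tree_rcons Tt eqxx orbT size_rcons Et; split=> //.
exact: prefix_trans st (prefix_rcons _ _).
Qed.

Lemma branching_level m : exists2 n, m <= n & g n.+1 != g n.
Proof.
apply: contrapT => H; have [g_mono g_unb] := g_order.
have E i : g (m + i) = g m.
  elim: i => [|i IH]; [by rewrite addn0 | rewrite addnS -[RHS]IH].
  by apply: contrapT => /eqP ne; apply: H; exists (m + i); rewrite ?leq_addr.
have [n Hn] := g_unb (g m).+1.
have := g_mono _ _ (leq_addl m n); rewrite E; lia.
Qed.

Lemma perfect_in_tree : perfect T.
Proof.
move=> s Ts; have [n sn gn] := branching_level (size s).
have [t [Tt st Et]] := in_tree_extend Ts sn.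
exists (rcons t true), (rcons t false).
have Hne b : prefix s (rcons t b) && (rcons t b != s).
  rewrite (prefix_trans st (prefix_rcons _ _)) /=.
  by apply/eqP => E; move: sn; rewrite -E size_rcons Et ltnn.
rewrite !in_tree_rcons Tt Et gn !Hne; split=> //.
by rewrite !prefixE !size_rcons !take_oversize ?size_rcons // !eqseq_rcons !andbF.
Qed.

Lemma sum_tuple_rcons n (F : seq bool -> nat) :
  \sum_(t : n.+1.-tuple bool) F t = \sum_(t : n.-tuple bool) \sum_(b : bool) F (rcons t b).
Proof.
rewrite pair_big /=.
pose h (u : n.-tuple bool * bool) : n.+1.-tuple bool := [tuple of rcons u.1 u.2].
have hB : bijective h.
  apply: inj_card_bij; last by rewrite card_prod !card_tuple card_bool expnS mulnC.
  move=> [t b] [t' b'] /(congr1 val) /= /eqP; rewrite eqseq_rcons => /andP[/eqP E /eqP ->].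
  by congr pair; apply: val_inj.
by rewrite (reindex h) //; exact: onW_bij.
Qed.

Lemma card_level n : #|level T n| = 2 ^ g n.
Proof.
have -> : #|level T n| = \sum_(t : n.-tuple bool) T t.
  rewrite -sum1_card big_mkcond /=; apply: eq_bigr => t _.
  by rewrite inE; case: (T t).
elim: n => [|n IH].
  by rewrite (eq_bigr (fun=> 1)) => [|t _]; rewrite ?tuple0 // sum1_card card_tuple g0.
rewrite (@sum_tuple_rcons n (fun s => T s)).
have -> : 2 ^ g n.+1 = 2 ^ g n * (if g n.+1 != g n then 2 else 1).
  have [g_mono _] := g_order; have := g_mono _ _ (leqnSn n); have := g_step n.
  case: eqP => [->|] /=; first by rewrite muln1.
  by move=> ne le1 le2; rewrite -expnSr; congr (2 ^ _); lia.
rewrite -IH big_distrl /=; apply: eq_bigr => t _.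
rewrite big_bool /= !in_tree_rcons size_tuple.
by case: (T t) => //; case: eqP => // _; case: (z _).
Qed.

Lemma tree_in_tree : tree T.
Proof.
split=> [||b]; first exact: in_tree_prefix.
- move=> s Ts; have [t [Tt st Et]] := in_tree_extend Ts (leqnSn (size s)).
  by exists t; split=> //; apply/eqP => E; move: Et; rewrite E; lia.
- have [_ /(_ b)[n bn]] := g_order.
  by exists n; rewrite card_level; apply: leq_trans bn (ltnW (ltn_expl _ _)).
Qed.

End Tree.

(** * Bounded mass makes the programs of strings in the tree long *)

Section Excess.
Local Open Scope nat_scope.
Set Implicit Arguments.
Unset Strict Implicit.

Lemma stage_evaluator_prefix_free U c E :
  (forall p s, U p s <-> reval no_oracle c [:: code_str p] (code_str s)) ->
  (forall p q s t, U p s -> U q t -> prefix p q -> p = q) ->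
  stage_evaluator no_oracle c 1 E ->
  forall t p q, E t [:: code_str p] != 0 -> E t [:: code_str q] != 0 ->
    prefix p q -> p = q.
Proof.
move=> Uc Upf [_ _ HE] t p q Hp Hq.
have HU r : E t [:: code_str r] != 0 -> U r (str_of_code (E t [:: code_str r]).-1).
  move=> e0; apply/Uc/HE => //; exists t.
  by rewrite str_of_codeK prednK // lt0n.
exact: Upf (HU _ Hp) (HU _ Hq).
Qed.

Lemma leq_sum_subseq (r : seq nat) L (F : nat -> nat) : uniq r ->
  {in r, forall q, q < L} -> \sum_(q <- r) F q <= \sum_(q < L) F q.
Proof.
move=> Ur rL; rewrite -(big_mkord xpredT F) [leqRHS](bigID (mem r)) /=.
apply: leq_trans (leq_addr _ _); rewrite -[leqRHS]big_filter.
apply/eq_leq/perm_big/uniq_perm => // [|q]; first by rewrite filter_uniq ?iota_uniq.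
rewrite mem_filter mem_index_iota /=; have [/rL|//] := boolP (q \in r).
by move=> ->.
Qed.

(* If [mass] stays below [2 ^ (k + L)], only finitely many programs can be short,
   as each of them contributes at least [2 ^ (L - j)]. *)
Lemma short_programs_finite g c E z k j : stage_evaluator no_oracle c 1 E ->
  (forall L, mass g E L z < 2 ^ (k + L)) ->
  exists N, forall s p, N <= size s -> in_tree g z s ->
    reval no_oracle c [:: code_str p] (code_str s) ->
    size s - g (size s) + j <= size p.
Proof.
move=> [_ E_mono HE] Hmass; apply: contrapT => Hex.
pose short q s := [/\ in_tree g z s, reval no_oracle c [:: q] (code_str s)
  & code_size q < size s - g (size s) + j].
have Hshort N : exists q s, N <= size s /\ short q s.
  apply: contrapT => H; apply: Hex; exists N => s p Ns Ts Ups.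
  rewrite leqNgt; apply/negP => lt; apply: H; exists (code_str p), s.
  by split=> //; split=> //; rewrite code_sizeE.
(* Terms of size [2 ^ (L - j)] exceed the bound once there are [2 ^ (k + j)] of them. Each new
   program is chosen with an output longer than all earlier outputs, so it differs from the earlier
   programs. *)
have [r [N [sz_r Ur Hr]]] : exists r N, [/\ size r = 2 ^ (k + j), uniq r
    & forall q, q \in r -> exists2 s, size s < N & short q s].
  elim: (2 ^ (k + j)) => [|M [r [N [sz Ur Hr]]]]; first by exists [::], 0.
  have [q [s [Ns qs]]] := Hshort N.
  exists (q :: r), (size s).+1; rewrite /= sz Ur andbT; split=> //.
    apply/negP => /Hr[s' s'N [_ Us' _]]; have [_ Us _] := qs.
    by move: s'N; rewrite (can_inj code_strK (reval_fun Us' Us)) ltnNge Ns.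
  move=> q'; rewrite inE => /predU1P[->|/Hr[s' s'N]]; first by exists s.
  by exists s' => //; lia.
(* At some common stage all the chosen programs are within the range of the sum, have halted, and
   have outputs with code at most the stage. *)
have [L HL] : exists L, forall L', L <= L' -> forall i, i < size r ->
    nth 0 r i < L' /\ 2 ^ (L' - j) <= mass_term g E L' z (nth 0 r i).
  apply: eventually_all => i /(mem_nth 0)/Hr[s _ []].
  move: (nth 0 r i) => q Ts /HE[//|t Et] short_q.
  exists (maxn t (maxn (code_str s) q.+1)) => L; rewrite !geq_max => /and3P[tL sL qL].
  split=> //; rewrite /mass_term (E_mono t) ?Et //= sL code_strK Ts code_sizeE leq_exp2l //.
  lia.
(* With [j <= L'] the exponents [k + j] and [L' - j] add up to [k + L']. *)
pose L' := maxn L j; have {}HL := HL L' (leq_maxl _ _).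
have rP q : q \in r -> q < L' /\ 2 ^ (L' - j) <= mass_term g E L' z q.
  by move=> qr; rewrite -(nth_index 0 qr); apply: HL; rewrite index_mem.
have := Hmass L'; rewrite ltnNge => /negP; apply.
apply: leq_trans (leq_sum_subseq (mass_term g E L' z) Ur (fun q qr => (rP q qr).1)).
apply: leq_trans (_ : \sum_(q <- r) 2 ^ (L' - j) <= _); last first.
  by rewrite !big_seq; apply: leq_sum => q /rP[].
rewrite big_const_seq count_predT iter_addn_0 sz_r mulnC -expnD leq_exp2l //.
rewrite /L'; lia.
Qed.

End Excess.

Theorem theorem1p5 (R : realType)
    (U : bitseq -> bitseq -> Prop) (hU : optimal_machine R U)
    (g : nat -> nat) (g_comp : computable_fun g) (g_order : order_fun g)
    (g0 : g 0%N = 0%N) (g_step : forall n, (g n.+1 <= g n + 1)%N)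
    (z : nat -> bool) (hz : ml_random R z) :
  exists T : pred bitseq,
    [/\ computes_strset z T, tree T, perfect T,
        forall n, log2 (#|level T n|%:R : R) = (g n)%:R
      & (fun n => (log2 (#|level T n|%:R : R))%:E
                  - deficiency R U (level_set T n))%E @ \oo --> +oo%E].
Proof.
have [[[c Uc] U_prefix_free] _] := hU.
have [E HE] := stage_evaluator_exists no_oracle c 1.
have E_prefix_free := stage_evaluator_prefix_free Uc U_prefix_free HE.
have [E_comp E_mono _] := HE; have [g_mono _] := g_order.
have test : ml_test R (mass_test g E).
  split; first exact: mass_test_ce.
  move=> k; apply: uniform_measure_le => [X L L'|L]; first exact: mass_test_mono.
  apply: leq_trans (card_mass_test g_mono g0 g_step E_prefix_free k L).
  rewrite leq_mul2r; apply/orP; right; apply: subset_leq_card.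
  by apply/fintype.subsetP => x; rewrite !inE => /mass_testE.
(* Some level [k] of the test misses z, so no initial segment of z is in it. *)
have [k z_k] : exists k, forall L, (mass g E L z < 2 ^ (k + L))%N.
  apply: contrapT => H; apply: (hz _ test) => k _ /=.
  apply: contrapT => Hk; apply: H; exists k => L; rewrite ltnNge; apply/negP => HL.
  by apply: Hk; exists (mkseq z L); [apply/mass_testE|rewrite size_mkseq].
have log_level n : log2 (#|level (in_tree g z) n|%:R : R) = (g n)%:R.
  rewrite card_level // natrX /log2 lnXn ?ltr0n // -[_ *+ g n]mulr_natl mulfK //.
  by rewrite gt_eqF // ln_gt0 // ltr1n.
exists (in_tree g z); split=> //.
- exact: in_tree_computable.
- exact: tree_in_tree.
- exact: perfect_in_tree.
apply/cvgeyPge => A; pose j := Num.bound `|A|.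
have Aj : A <= j%:R by apply: le_trans (ler_norm A) (ltW (archi_boundP (normr_ge0 A))).
have [N HN] := short_programs_finite j HE z_k.
exists N => // n /= Nn; rewrite log_level.
have : (deficiency R U (level_set (in_tree g z) n) <= ((g n)%:R - j%:R)%:E)%E.
  apply: ge_ereal_sup => d [s [t]]; rewrite /= inE => Tt <- <-.
  have : ((n - g n + j)%:R%:E <= complexity R U (tval t))%E.
    apply: le_ereal_inf_tmp => _ [p /= Upt <-]; rewrite lee_fin ler_nat.
    have := HN (tval t) p; rewrite size_tuple; apply=> //.
    exact/Uc.
  (* A string without programs has complexity +oo and contributes -oo to the supremum; the value -oo
     is excluded by the lower bound. *)
  rewrite size_tuple; case: (complexity R U t) => [x| |] //; last by rewrite leNye.
  rewrite !lee_fin natrD natrB ?g_le //.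
  by lra.
case: (deficiency _ _ _) => [x| |] //; rewrite ?leey //.
by rewrite !lee_fin; lra.
Qed.
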